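(* Let $n\ge 2$ and let $k$ be an integer with $1\le k\le [n/2]$. Let $A$ be an $n\times n$ matrix with integer entries and $f(x)$ its characteristic polynomial. Then $\det(I-\bigwedge^k A)\in\{1,-1\}$ if and only if, for every prime number $p$, the reduction $f_p(x)\in\mathbb{F}_p[x]$ of $f(x)$ modulo $p$ is $k$-regular over $\mathbb{F}_p$.
   Context: $\bigwedge^k A$ denotes the $k$-th exterior power (compound matrix) of $A$ and $I$ the identity matrix of the same size. The characteristic polynomial is monic. Let $K$ be a field with algebraic closure $\overline{K}$, and let $f(x)\in K[x]$ be monic of degree $n$ with roots $\alpha_1,\ldots,\alpha_n\in\overline{K}$ listed with multiplicity. For an integer $k$ with $1\le k\le [n/2]$, $f$ is called $k$-regular over $K$ if $\alpha_{i_1}\cdots\alpha_{i_k}\neq 1$ for every $k$-tuple of integers with $1\le i_1<\cdots<i_k\le n$. *)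

(* Defs.v *)
From HB Require Import structures.
From mathcomp Require Import all_boot all_order all_algebra all_field.

Set Implicit Arguments.
Unset Strict Implicit.
Unset Printing Implicit Defensive.

Import GRing.Theory.
Local Open Scope ring_scope.

(* The k-tuples i_1 < ... < i_k of elements of {0, ..., n-1}. *)
Definition incr_tuples (n k : nat) : {set k.-tuple 'I_n} :=
  [set t : k.-tuple 'I_n | sorted ltn (map val t)].

(* Its size #|incr_tuples n k| is 'C(n, k), by card_ltn_sorted_tuples; rows and
   columns are both listed in the order of enum (incr_tuples n k). *)
Definition compound (R : comNzRingType) (n k : nat) (A : 'M[R]_n) :
    'M[R]_#|incr_tuples n k| :=
  \matrix_(i, j) \det (mxsub (tnth (enum_val i)) (tnth (enum_val j)) A).

(* MathComp constructs algebraic closures of countable fields only. *)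
Definition alg_closure (K : countFieldType) : countClosedFieldType :=
  projT1 (countable_algebraic_closure K).

Definition alg_closure_inj (K : countFieldType) :
    {rmorphism K -> alg_closure K} :=
  proj1_sig (projT2 (countable_algebraic_closure K)).

Lemma alg_closure_integral (K : countFieldType) :
  integralRange (alg_closure_inj K).
Proof. exact: proj2_sig (projT2 (countable_algebraic_closure K)). Qed.

(* Meant for f monic and iota an embedding of K into an algebraic closure Kbar;
   alpha is then a listing of the roots of f in Kbar, with multiplicity, and
   size alpha = deg f. *)
Definition kregular (K : fieldType) (Kbar : closedFieldType)
    (iota : {rmorphism K -> Kbar}) (k : nat) (f : {poly K}) : Prop :=
  forall alpha : seq Kbar,
    map_poly iota f = \prod_(a <- alpha) ('X - a%:P) ->
  forall t : k.-tuple 'I_(size alpha),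
    t \in incr_tuples (size alpha) k -> \prod_(i <- t) alpha`_i != 1.

(* Main.v *)
(* Over a field where the characteristic polynomial of A splits as a product of
   the X - a_i, A is similar to a triangular matrix T with diagonal (a_i).  The
   compound is multiplicative by Cauchy-Binet, so compound k A is similar to
   compound k T, which is triangular for the partial order "sum of the indices"
   and has the k-fold products of the a_i on its diagonal.  Therefore
   det (1 - compound k A) is the product of the 1 - a_(i_1) ... a_(i_k).  Apply
   this over an algebraic closure of F_p for every p: an integer is 1 or -1 iff
   it is nonzero modulo every prime. *)
Require Import Defs.
From HB Require Import structures.
From mathcomp Require Import all_boot all_order all_fingroup all_algebra.
From mathcomp Require Import all_field.

Set Implicit Arguments.
Unset Strict Implicit.
Unset Printing Implicit Defensive.

Import GRing.Theory.
Local Open Scope ring_scope.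

(** * Increasing tuples *)

Lemma incr_tuples_inj n k (t : k.-tuple 'I_n) :
  t \in incr_tuples n k -> injective (tnth t).
Proof.
rewrite inE => t_incr; apply/tuple_uniqP.
rewrite -(map_inj_uniq val_inj); exact: sorted_uniq ltn_trans ltnn _ t_incr.
Qed.

Lemma incr_tuples_eq n k (t u : k.-tuple 'I_n) :
  t \in incr_tuples n k -> u \in incr_tuples n k -> t =i u -> t = u.
Proof.
rewrite !inE => t_incr u_incr eq_tu; apply/val_inj/(inj_map val_inj).
apply: irr_sorted_eq t_incr u_incr _; [exact: ltn_trans | exact: ltnn |].
by move=> x; apply/mapP/mapP=> -[y y_in ->]; exists y; rewrite ?eq_tu // -eq_tu.
Qed.

(** Both tuples have the same set of entries, which determines an increasing tuple. For minors, [s]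
    will come from a nonvanishing Leibniz term. *)
Lemma incr_tuples_perm_eq n k (t u : k.-tuple 'I_n) (s : 'S_k) :
    t \in incr_tuples n k -> u \in incr_tuples n k ->
  (forall a, tnth t a = tnth u (s a)) -> t = u.
Proof.
move=> t_incr u_incr tuE; apply: incr_tuples_eq => // x.
apply/tnthP/tnthP => -[a ->]; first by exists (s a); rewrite tuE.
by exists ((s^-1)%g a); rewrite tuE permKV.
Qed.

Lemma incr_tuples_lt n k (t : k.-tuple 'I_n) (a b : 'I_k) :
  t \in incr_tuples n k -> (a < b)%N -> (tnth t a < tnth t b)%N.
Proof.
rewrite inE => t_incr lt_ab; have x0 := tnth t a.
have := sorted_ltn_nth ltn_trans (val x0) t_incr.
move=> /(_ a b); rewrite !inE size_map size_tuple !ltn_ord.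
move=> /(_ isT isT lt_ab).
by rewrite !(nth_map x0) ?size_tuple // -!tnth_nth.
Qed.

(* An injective function factors uniquely as a permutation followed by the
   increasing enumeration of its image. *)
Lemma injective_ffuns_incr_tuples n k :
  [set f : {ffun 'I_k -> 'I_n} | injectiveb f] =
  [set [ffun i => tnth p.1 (p.2 i)]
     | p : k.-tuple 'I_n * 'S_k in setX (incr_tuples n k) [set: 'S_k]].
Proof.
apply/setP=> f; rewrite inE; apply/idP/imsetP=> [f_inj|[[t s]]]; last first.
  rewrite !inE andbT => t_incr ->; apply/injectiveP => i j.
  rewrite !ffunE => /incr_tuples_inj; rewrite inE => /(_ t_incr).
  exact: perm_inj.
pose le_ord := relpre (@nat_of_ord n) leq.
have le_ord_total : total le_ord by move=> i j; apply: leq_total.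
pose u := [tuple f i | i < k].
have u_uniq : uniq u by exact: f_inj.
have size_u : size (sort le_ord u) == k by rewrite size_sort size_tuple.
have /tuple_permP[s uE] : perm_eq u (Tuple size_u).
  by rewrite perm_sym perm_sort.
exists (Tuple size_u, s).
  rewrite !inE andbT ltn_sorted_uniq_leq (map_inj_uniq val_inj) sort_uniq.
  by rewrite u_uniq /= sorted_map; apply: sort_sorted.
apply/ffunP=> i; rewrite ffunE /=.
have := congr1 (fun v : k.-tuple 'I_n => tnth v i) (val_inj uE).
by rewrite !tnth_mktuple.
Qed.

Lemma ffun_incr_tuples_inj n k :
  {in setX (incr_tuples n k) [set: 'S_k] &,
    injective (fun p : k.-tuple 'I_n * 'S_k => [ffun i => tnth p.1 (p.2 i)])}.
Proof.
move=> [t s] [u r]; rewrite !in_setX !in_setT !andbT /=.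
move=> t_incr u_incr /ffunP tuE.
have eq_tu : t = u.
  apply: (@incr_tuples_perm_eq _ _ _ _ (s^-1 * r)%g) => // a.
  by have := tuE ((s^-1)%g a); rewrite !ffunE permKV permM.
congr (_, _) => //; apply/permP => i; apply: (incr_tuples_inj t_incr).
by have := tuE i; rewrite !ffunE eq_tu.
Qed.

(** * Cauchy-Binet, compounds and triangularity *)

Lemma Cauchy_Binet (R : comNzRingType) m n (A : 'M[R]_(m, n)) (B : 'M_(n, m)) :
  \det (A *m B) = \sum_(t in incr_tuples n m)
    \det (colsub (tnth t) A) * \det (rowsub (tnth t) B).
Proof.
(* Expand each entry of the product inside the Leibniz formula for the determinant and exchange the
   sums: [f] records the middle index chosen in each row. *)
have detE : \det (A *m B) = \sum_(f : {ffun 'I_m -> 'I_n})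
    (\prod_i A i (f i)) * \det (rowsub f B).
  pose AB (s : 'S_m) i j := A i j * B j (s i).
  transitivity (\sum_(f : {ffun 'I_m -> 'I_n}) \sum_(s : 'S_m)
      (-1) ^+ s * \prod_i AB s i (f i)).
    rewrite exchange_big; apply: eq_bigr => /= s _; rewrite -big_distrr /=.
    congr (_ * _); rewrite -(bigA_distr_bigA (AB s)) /=.
    by apply: eq_bigr => x _; rewrite mxE.
  apply: eq_bigr => f _; rewrite big_distrr; apply: eq_bigr => s _ /=.
  rewrite mulrCA big_split //=; congr (_ * (_ * _)).
  by apply: eq_bigr => x _; rewrite mxE.
rewrite {}detE (bigID (fun f : {ffun _} => injectiveb f)) /= addrC.
(* A non-injective [f] repeats a row of [B]. An injective one is an increasing tuple composed with a
   permutation, whose sign rebuilds the minor of [A]. *)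
rewrite big1 ?add0r => [|f /injectivePn[i1 [i2 neq_i eq_f]]]; last first.
  by rewrite (determinant_alternate neq_i) ?mulr0 // => j; rewrite !mxE eq_f.
rewrite -big_set injective_ffuns_incr_tuples big_imset /=; last first.
  exact: ffun_incr_tuples_inj.
rewrite (eq_bigl (fun p => (p.1 \in incr_tuples n m) && true)); last first.
  by move=> [t s]; rewrite in_setX in_setT.
under [RHS]eq_bigr do rewrite big_distrl /=.
rewrite [RHS]pair_big; apply: eq_bigr => -[t s] _ /=.
have -> : rowsub [ffun i => tnth t (s i)] B = row_perm s (rowsub (tnth t) B).
  by apply/matrixP => i j; rewrite !mxE ffunE.
rewrite row_permE det_mulmx det_perm mulrA; congr (_ * _).
rewrite mulrC; congr (_ * _); apply: eq_bigr => i _.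
by rewrite mxE ffunE.
Qed.

Lemma compound_mulmx (R : comNzRingType) n k (A B : 'M[R]_n) :
  compound k (A *m B) = compound k A *m compound k B.
Proof.
apply/matrixP => i j; rewrite !mxE mxsub_mul Cauchy_Binet big_enum_val /=.
by apply: eq_bigr => l _; rewrite !mxE; congr (_ * _); congr (\det _);
  apply/matrixP => a b; rewrite !mxE.
Qed.

Lemma map_compound (R S : comNzRingType) (f : {rmorphism R -> S}) n k
    (A : 'M[R]_n) :
  map_mx f (compound k A) = compound k (map_mx f A).
Proof. by apply/matrixP => i j; rewrite !mxE -det_map_mx map_mxsub. Qed.

(** Otherwise every Leibniz term has a zero factor. This turns a nonzero minor into a matching of
    its rows with its columns. *)
Lemma det_neq0_perm (R : comNzRingType) n (A : 'M[R]_n) :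
  \det A != 0 -> exists s : 'S_n, forall i, A i (s i) != 0.
Proof.
move=> detA.
case: (pickP (fun s : 'S_n => [forall i, A i (s i) != 0])) => [s /forallP|no_s].
  by exists s.
case/eqP: detA; apply: big1 => s _; have /negbT := no_s s.
rewrite negb_forall => /existsP[i /negPn/eqP Ai0].
by rewrite (bigD1 i) //= Ai0 mul0r mulr0.
Qed.

(* Triangularity with respect to a weight on the indices, so that the
   order in which the index set is enumerated is irrelevant. *)
Lemma det_weight_trig (R : comNzRingType) n (w : 'I_n -> nat) (A : 'M[R]_n) :
  (forall i j, i != j -> A i j != 0 -> (w j < w i)%N) ->
  \det A = \prod_i A i i.
Proof.
move=> Aw; rewrite /determinant (bigD1 1%g) //= odd_perm1 mul1r.
rewrite [X in _ + X]big1 ?addr0 => [|s neq_s1].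
  by apply: eq_bigr => i _; rewrite perm1.
case: (pickP (fun i => A i (s i) == 0)) => [i /eqP Ai0|A_neq0].
  by rewrite (bigD1 i) //= Ai0 mul0r mulr0.
(* Along [s] no weight increases, yet a permutation preserves the total weight. Equality thus holds
   everywhere, which forces [s] to be the identity. *)
have le_w i : true -> (w (s i) <= w i ?= iff (s i == i))%N.
  have [->|neq_si] := eqVneq (s i) i => _; first exact: leqif_refl.
  have lt_w : (w (s i) < w i)%N by apply: Aw; rewrite ?A_neq0 // eq_sym.
  by split; [exact: ltnW | rewrite ltn_eqF].
have [_] := leqif_sum le_w.
rewrite [X in _ == X](reindex_perm s) eqxx => /esym/forallP s1.
by case/eqP: neq_s1; apply/permP => i; rewrite perm1; apply/eqP/s1.
Qed.

Lemma compound1 (R : comNzRingType) n k : compound k (1%:M : 'M[R]_n) = 1%:M.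
Proof.
apply/matrixP => i j; rewrite !mxE.
have [<-|neq_ij] := eqVneq i j.
  rewrite -[RHS](det1 _ k); congr (\det _); apply/matrixP => a b.
  by rewrite !mxE (inj_eq (incr_tuples_inj (enum_valP i))).
apply/eqP; apply: contraNT neq_ij => /det_neq0_perm[s sP].
apply/eqP/enum_val_inj/(incr_tuples_perm_eq (s := s)); try exact: enum_valP.
by move=> a; have := sP a; rewrite !mxE; apply: contraNeq => /negPf->.
Qed.

Lemma compound_unitmx (F : fieldType) n k (P : 'M[F]_n) :
  P \in unitmx -> compound k P \in unitmx.
Proof.
move=> uP; apply: (@mulmx1_unit _ _ _ (compound k (invmx P)) _).1.
by rewrite -compound_mulmx mulmxV // compound1.
Qed.

Lemma compound_trig_diag (R : comNzRingType) n k (T : 'M[R]_n) i :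
  is_trig_mx T ->
  compound k T i i = \prod_(j <- enum_val i : k.-tuple 'I_n) T j j.
Proof.
move=> /is_trig_mxP T_trig; rewrite mxE det_trig.
  by rewrite big_tuple; apply: eq_bigr => a _; rewrite mxE.
apply/is_trig_mxP => a b lt_ab; rewrite mxE T_trig //.
by apply: incr_tuples_lt lt_ab; apply: enum_valP.
Qed.

(** A nonzero minor matches each row index with a column index that is no larger, [T] being lower
    triangular. The index sum therefore drops, strictly unless the two tuples agree up to a
    permutation and so coincide. *)
Lemma compound_trig_weight (R : comNzRingType) n k (T : 'M[R]_n)
    (w := fun i : 'I_#|incr_tuples n k| => (\sum_a tnth (enum_val i) a)%N) i j :
  is_trig_mx T -> i != j -> compound k T i j != 0 -> (w j < w i)%N.
Proof.
move=> /is_trig_mxP T_trig neq_ij; rewrite mxE => /det_neq0_perm[s sP].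
have le_ts a : true -> (tnth (enum_val j) (s a) <= tnth (enum_val i) a
    ?= iff (tnth (enum_val j) (s a) == tnth (enum_val i) a))%N.
  split=> //; rewrite leqNgt; apply: contra (sP a) => lt_a.
  by rewrite mxE T_trig.
have ltE := ltn_leqif (leqif_sum le_ts).
rewrite /w [X in (X < _)%N](reindex_perm s) ltE.
apply: contra neq_ij => /forallP eq_ts.
apply/eqP/enum_val_inj/(incr_tuples_perm_eq (s := s)); try exact: enum_valP.
by move=> a; apply/esym/eqP/eq_ts.
Qed.

(** * Trigonalization *)

Lemma char_poly_lblock (R : comNzRingType) m n (A : 'M[R]_m) (C : 'M_(n, m))
    (D : 'M_n) :
  char_poly (block_mx A 0 C D) = char_poly A * char_poly D.
Proof.
rewrite /char_poly /char_poly_mx map_block_mx map_mx0 scalar_mx_block.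
by rewrite opp_block_mx add_block_mx oppr0 addr0 det_lblock.
Qed.

Lemma char_poly_simmx (F : fieldType) n (P A B : 'M[F]_n) :
  P \in unitmx -> P *m A = B *m P -> char_poly A = char_poly B.
Proof.
move=> uP PA; have uPX : \det (map_mx polyC P) != 0.
  by rewrite det_map_mx polyC_eq0 -unitfE -unitmxE.
apply: (mulfI uPX); rewrite [RHS]mulrC -!det_mulmx.
rewrite /char_poly_mx mulmxBr mulmxBl -!map_mxM PA.
by rewrite scalar_mxC.
Qed.

(** Induction on [n]: split off a left eigenvector for the first root and recurse on the
    complementary block, which has the remaining roots. By degree [alpha] has size [n], so the
    default of [nth] is never reached. *)
Lemma trigonalize (F : fieldType) n (alpha : seq F) (A : 'M[F]_n) :
    char_poly A = \prod_(a <- alpha) ('X - a%:P) ->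
  exists2 P : 'M_n, P \in unitmx &
    exists2 T : 'M_n, is_trig_mx T /\ (forall i, T i i = alpha`_i)
      & P *m A = T *m P.
Proof.
elim: n alpha A => [|n IHn] alpha A charA.
  exists 1%:M; first exact: unitmx1.
  exists A; last by rewrite mul1mx mulmx1.
  by split=> [|[]//]; apply/is_trig_mxP => -[].
have := size_char_poly A; rewrite charA size_prod_XsubC => -[].
case: alpha charA => // a alpha; rewrite big_cons => charA _.
have /eigenvalueP[v vA v_neq0] : eigenvalue A a.
  by rewrite eigenvalue_root_char charA rootM root_XsubC eqxx.
rewrite -[n.+1]/(1 + n)%N in A charA v vA v_neq0 *.
pose Q := row_ebase v; have uQ : Q \in unitmx := row_ebase_unit v.
have [D [C QA]] : exists D : 'M_n, exists C, Q *m A = block_mx a%:M 0 C D *m Q.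
  (* The first row of [Q] is a nonzero multiple of [v], hence also a left eigenvector for [a]. *)
  have QE : usubmx Q = invmx (col_ebase v) *m v.
    rewrite -{2}(mulmx_ebase v) rank_rV v_neq0 -/Q -{2}(vsubmxK Q) -mulmxA.
    rewrite pid_mx_row mul_row_col mul1mx mul0mx addr0 mulKmx //.
    exact: col_ebase_unit.
  (* [CD] holds the images under [A] of the other rows of [Q], in coordinates relative to [Q]. *)
  pose CD := dsubmx Q *m A *m invmx Q; exists (rsubmx CD), (lsubmx CD).
  rewrite -{1}(vsubmxK Q) mul_col_mx {1}QE -mulmxA vA -scalemxAr -QE.
  rewrite /block_mx hsubmxK mul_col_mx mulmxKV //; congr col_mx.
  by rewrite -[in RHS](vsubmxK Q) mul_row_col mul0mx addr0 mul_scalar_mx.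
have charD : char_poly D = \prod_(a <- alpha) ('X - a%:P).
  have := char_poly_simmx uQ QA; rewrite charA char_poly_lblock.
  have -> : char_poly (a%:M : 'M_1) = 'X - a%:P.
    by rewrite char_poly_trig ?scalar_mx_is_trig // big_ord1 mxE.
  by move/(mulfI (monic_neq0 (monicXsubC a))).
have [P uP [T [T_trig T_diag] PD]] := IHn _ _ charD.
exists (block_mx 1%:M 0 0 P *m Q).
  by rewrite unitmx_mul block_diag_mx_unit unitmx1 uP.
exists (block_mx a%:M 0 (P *m C) T).
  split; first by rewrite is_trig_block_mx // eqxx scalar_mx_is_trig.
  move=> i; case: (split_ordP i) => j ->.
    by rewrite block_mxEul mxE eqxx ord1.
  by rewrite block_mxEdr T_diag.
rewrite -mulmxA QA !mulmxA !mulmx_block.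
by rewrite !(mul0mx, mulmx0, mul1mx, mulmx1, addr0, add0r) PD.
Qed.

(** * The determinant and its reductions modulo primes *)

Lemma det_1_sub_compound (F : fieldType) n k (alpha : seq F) (A : 'M[F]_n) :
    char_poly A = \prod_(a <- alpha) ('X - a%:P) ->
  \det (1%:M - compound k A) =
    \prod_(t in incr_tuples n k) (1 - \prod_(i <- t) alpha`_i).
Proof.
move=> /trigonalize[P uP [T [T_trig T_diag] PA]].
have uQ := compound_unitmx k uP.
have -> : \det (1%:M - compound k A) = \det (1%:M - compound k T).
  have detQ : \det (compound k P) != 0 by rewrite -unitfE -unitmxE.
  apply: (mulfI detQ); rewrite [RHS]mulrC -!det_mulmx mulmxBr mulmxBl.
  by rewrite -!compound_mulmx PA mulmx1 mul1mx.
pose w (i : 'I_#|incr_tuples n k|) := (\sum_a tnth (enum_val i) a)%N.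
rewrite (det_weight_trig (w := w)).
  rewrite [RHS]big_enum_val; apply: eq_bigr => i _.
  rewrite 2!mxE eqxx mxE compound_trig_diag //; congr (_ - _).
  by apply: eq_bigr => j _.
move=> i j neq_ij; rewrite 3!mxE (negPf neq_ij) sub0r oppr_eq0.
exact: compound_trig_weight.
Qed.

Lemma pm1_Fp_neq0P (d : int) :
  (d = 1 \/ d = -1) <-> (forall p : nat, prime p -> (d%:~R : 'F_p) != 0).
Proof.
split=> [d1 p p_pr|d_unit].
  by case: d1 => ->; rewrite ?rmorphN1 ?oppr_eq0 oner_eq0.
have d1 : `|d|%N = 1%N.
  (* Zero vanishes modulo any prime, here 2. An absolute value above 1 has a prime divisor. *)
  case: (ltngtP `|d|%N 1%N) => // [|/pdivP[p p_pr p_dvd]].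
    rewrite ltnS leqn0 absz_eq0 => /eqP d0.
    by have := d_unit 2 isT; rewrite d0 eqxx.
  by have := d_unit p p_pr; rewrite -(dvdz_pcharf (pchar_Fp p_pr)) dvdzE p_dvd.
by case: d d1 {d_unit} => [[|[]]|[]] // _; [left | right].
Qed.

Theorem proposition3p6 (n k : nat) (A : 'M[int]_n) :
  (2 <= n)%N -> (1 <= k <= n./2)%N ->
  (\det (1%:M - compound k A) = 1 \/ \det (1%:M - compound k A) = -1)
  <-> (forall p : nat, prime p ->
        kregular (alg_closure_inj 'F_p) k
          (map_poly (intr : int -> 'F_p) (char_poly A))).
Proof.
move=> _ _; apply: (iff_trans (pm1_Fp_neq0P _)).
suff kregP p : (((\det (1%:M - compound k A))%:~R : 'F_p) != 0) <->
    kregular (alg_closure_inj 'F_p) k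
      (map_poly (intr : int -> 'F_p) (char_poly A)).
  by split=> H p p_pr; apply/kregP/H.
(* The embedding is injective, so nonvanishing can be tested in the closure. Everything commutes
   with ring morphisms and becomes a statement about the image [B] of [A]. *)
rewrite /kregular !map_char_poly -(fmorph_eq0 (alg_closure_inj 'F_p)).
rewrite -!det_map_mx !map_mxB !map_mx1 !map_compound.
set B := map_mx _ (map_mx _ A).
split=> [detB alpha charB|kreg].
  (* Comparing degrees identifies the tuples of [kregular] with those indexing the compound. *)
  have {}size_alpha : size alpha = n.
    by have := size_char_poly B; rewrite charB size_prod_XsubC => -[].
  move: detB; rewrite (det_1_sub_compound _ charB) size_alpha.
  move=> /prodf_neq0 + t t_incr => /(_ t t_incr).
  by rewrite subr_eq0 eq_sym.
(* For the converse a single listing of the roots suffices; algebraic closedness provides it. *)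
have [alpha] := closed_field_poly_normal (char_poly B).
rewrite (monicP (char_poly_monic B)) scale1r => charB.
have size_alpha : size alpha = n.
  by have := size_char_poly B; rewrite charB size_prod_XsubC => -[].
have := kreg _ charB; rewrite (det_1_sub_compound _ charB) size_alpha => {}kreg.
by apply/prodf_neq0 => t /kreg; rewrite subr_eq0 eq_sym.
Qed.
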